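(* If $\Delta\subset N_{\mathbb R}$ is an almost reflexive polytope, then $\Delta^\bullet:=\mathrm{Conv}(\Delta^*\cap M)$ is almost reflexive (with respect to $M$), and the map $\Delta\mapsto\Delta^\bullet$ is an involution on the set of almost reflexive polytopes, i.e. $(\Delta^\bullet)^\bullet=\Delta$.
   Context: $M$ is a lattice of rank $d$, $N=\mathrm{Hom}(M,\mathbb Z)$ its dual lattice with the natural pairing $\langle\cdot,\cdot\rangle$, $M_{\mathbb R}=M\otimes\mathbb R$, $N_{\mathbb R}=N\otimes\mathbb R$. For a subset $P\subset N_{\mathbb R}$, $P^*=\{m\in M_{\mathbb R}\mid \langle m,n\rangle\ge-1\ \forall n\in P\}$ (and symmetrically for subsets of $M_{\mathbb R}$). A $d$-dimensional lattice polytope $\Delta\subset N_{\mathbb R}$ (vertices in $N$) is almost reflexive (with respect to $N$) if $0\in\mathrm{int}(\Delta)$ and $\mathrm{Conv}\big((\mathrm{Conv}(\Delta^*\cap M))^*\cap N\big)=\Delta$. The same notion is used in $M_{\mathbb R}$ with $M$ and $N$ exchanged; for $\Delta'\subset M_{\mathbb R}$, $(\Delta')^\bullet=\mathrm{Conv}((\Delta')^*\cap N)$. *)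

(* Defs.v *)
From HB Require Import structures.
From mathcomp Require Import all_boot all_order all_algebra.
From mathcomp Require Import all_classical all_reals all_analysis.

Set Implicit Arguments.
Unset Strict Implicit.
Unset Printing Implicit Defensive.

Import Order.TTheory GRing.Theory Num.Theory.
Import numFieldNormedType.Exports.

Local Open Scope classical_set_scope.
Local Open Scope ring_scope.

Section Polytopes.
Context {R : realType} {V : vectType R}.
Implicit Types (P L : set V) (d : nat).

Definition Conv P : set V := smallest (@convex_set R V) P.

(* A finite-dimensional real vector space carries the topology of R^n,
   transported along the coordinates in any basis; the choice of the basis is
   immaterial since linear automorphisms of R^n are homeomorphisms. *)
Definition coords : V -> 'rV[R]_(\dim {:V}) := passmx.rVof (vbasis {:V}).

Definition interiorV P : set V := coords @^-1` (coords @` P)°.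

(* The dimension of the affine hull of a nonempty P: U is the least vector
   subspace such that P lies in a translate of U. *)
Definition has_dim P d : Prop :=
  exists x (U : {vspace V}),
    [/\ P x,
        \dim U = d,
        forall y, P y -> y - x \in U &
        forall U' : {vspace V},
          (forall y, P y -> y - x \in U') -> (U <= U')%VS].

Definition polytope P : Prop := exists2 S : set V, finite_set S & P = Conv S.

Definition vertex P (x : V) : Prop :=
  P x /\ forall y z (t : R), P y -> P z -> 0 < t < 1 ->
    x = (1 - t) *: y + t *: z -> y = x /\ z = x.

Definition lattice_polytope L P : Prop := polytope P /\ vertex P `<=` L.

(* L is a lattice of rank d with L \otimes R = V: the integral span of a basis
   of V. *)
Definition is_lattice d L : Prop :=
  exists2 e : d.-tuple V, basis_of {:V} e & L = [set m | inIntSpan e m].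

End Polytopes.

(* The definitions below depend on a pairing V -> W -> R, so that they apply
   both to (M_R, N_R) and, with the pairing flipped, to (N_R, M_R). *)
Section Duality.
Context {R : realType} {V W : vectType R}.
Variable b : V -> W -> R.

Definition polar (P : set W) : set V := [set m | forall n, P n -> -1 <= b m n].

Definition bullet (LV : set V) (P : set W) : set V := Conv (polar P `&` LV).

End Duality.

Definition almost_reflexive {R : realType} {V W : vectType R}
    (b : V -> W -> R) (LV : set V) (LW : set W) (d : nat) (P : set W) : Prop :=
  [/\ lattice_polytope LW P,
      has_dim P d,
      interiorV P 0 &
      bullet (fun n m => b m n) LW (bullet b LV P) = P].

Section DualLattice.
Context {R : realType} {MR : vectType R}.

(* N_R is realized as the dual space Hom(M_R, R), which is Hom(M, Z) \otimes R:
   an element of Hom(M, Z) is identified with its unique R-linear extension. *)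
Definition NR : vectType R := 'Hom(MR, R^o).

Definition pairing (m : MR) (n : NR) : R := (n : 'Hom(MR, R^o)) m.

Definition dual_lattice (M : set MR) : set NR :=
  [set n | forall m, M m -> pairing m n \is a Num.int].

End DualLattice.

Arguments NR {R} MR.

Definition almost_reflexive_N {R : realType} {MR : vectType R} (d : nat)
    (M : set MR) : set (NR MR) -> Prop :=
  almost_reflexive pairing M (dual_lattice M) d.

Definition almost_reflexive_M {R : realType} {MR : vectType R} (d : nat)
    (M : set MR) : set MR -> Prop :=
  almost_reflexive (fun n m => pairing m n) (dual_lattice M) M d.

Definition bullet_N {R : realType} {MR : vectType R} (M : set MR) :
    set (NR MR) -> set MR :=
  bullet pairing M.

Definition bullet_M {R : realType} {MR : vectType R} (M : set MR) :
    set MR -> set (NR MR) :=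
  bullet (fun n m => pairing m n) (dual_lattice M).

(* Main.v *)
Require Import Defs.
From mathcomp Require Import all_boot all_order all_algebra.
From mathcomp Require Import all_classical all_reals all_analysis.
From mathcomp Require Import ring lra.

(** Both halves of the theorem are the same statement, about a perfect pairing
    between two lattices LV and LW, so everything is proved for a pair of dual
    bases ([dual_bases]) and applied to the pairing and to its flip.

    Let P be almost reflexive and Q the convex hull of the lattice points of
    its polar. The equality that the double bullet of P is P is part of the
    hypothesis; it gives the involution, and, after one more bullet, the same
    equality for Q. Since 0 is interior to P, the polar of P is bounded and
    contains finitely many lattice points ([finite_polar_lattice]). So Q is a
    polytope, and its vertices, being extreme points of a convex hull, are
    among these lattice points ([vertex_Conv]).

    What remains is that 0 is interior to Q, which also makes Q
    full-dimensional. A convex set has 0 in its interior iff some positive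
    multiple of every vector lies in it ([absorbing_interior]); thus the cone
    generated by Q has to be the whole space. If it were not, the Farkas lemma
    would produce a functional, nonnegative on Q and negative somewhere. As Q
    is generated by lattice points, this functional can be chosen in LW: this
    is [lattice_farkas], proved without leaving the lattices. All its
    natural multiples then lie in the polar of Q, hence in the double bullet
    of P, that is, in P; but P is bounded ([absorbing_polar]), a
    contradiction ([absorbing_bullet]). *)

Set Implicit Arguments.
Unset Strict Implicit.
Unset Printing Implicit Defensive.

Import Order.TTheory GRing.Theory Num.Theory.
Import numFieldNormedType.Exports.

Local Open Scope classical_set_scope.
Local Open Scope ring_scope.

(** * Convex hulls *)

Section ConvexHull.
Context {R : realType} {V : vectType R}.
Implicit Types (P S : set V) (x y v : V) (t : R).

Lemma convex_setP P : convex_set P <->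
  forall x y t, P x -> P y -> 0 <= t <= 1 -> P (t *: x + (1 - t) *: y).
Proof.
split=> [cP x y t Px Py /andP[t0 t1]|cP x y t].
  have := cP x y (Itv01 t0 t1); rewrite !inE => /(_ Px Py); exact.
rewrite !inE => Px Py; apply: cP => //.
by apply/andP; split; [exact: ge0 | exact: le1].
Qed.

Lemma convex_Conv S : convex_set (Conv S).
Proof.
apply/convex_setP => x y t Sx Sy t01 A [cA SA].
by move/convex_setP : (cA); apply => //; [exact: Sx|exact: Sy].
Qed.

Lemma sub_Conv S : S `<=` Conv S.
Proof. exact: sub_gen_smallest. Qed.

Lemma Conv_min S P : convex_set P -> S `<=` P -> Conv S `<=` P.
Proof. exact: smallest_sub. Qed.

(** Removing an extreme point from a convex set leaves a convex set; if the
    point were not a generator, this smaller set would still contain S. *)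
Lemma vertex_Conv S : vertex (Conv S) `<=` S.
Proof.
move=> x [Sx extx]; apply: contrapT => nSx.
suff [_] : (Conv S `\ x) x by apply.
apply: (Conv_min _ _ Sx); last first.
  by move=> y Sy; split; [exact: sub_Conv | move=> yx; apply: nSx; rewrite -yx].
apply/convex_setP => y z t [Sy yx] [Sz zx] /andP[t0 t1].
split.
  by apply: (iffLR (convex_setP _) (convex_Conv (S := S))) => //; rewrite t0.
move=> /= xE.
have [t00|tn0] := eqVneq t 0.
  by apply: zx; rewrite /= -xE t00 scale0r add0r subr0 scale1r.
have [t11|tn1] := eqVneq t 1.
  by apply: yx; rewrite /= -xE t11 scale1r subrr scale0r addr0.
have [||zxE _] := extx z y t Sz Sy; last exact: zx.
- by rewrite lt_def tn0 t0 lt_neqAle tn1.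
- by rewrite addrC.
Qed.

End ConvexHull.

(** * Absorbing sets and interior points *)

Section Absorbing.
Context {R : realType} {V : vectType R}.
Implicit Types (P : set V) (x y v : V).

(** For a convex set, this is the basis-free form of having 0 in the
    interior. *)
Definition absorbing P := forall v, exists2 t : R, 0 < t & P (t *: v).

Lemma absorbing0 P : absorbing P -> P 0.
Proof. by move=> /(_ 0)[t _]; rewrite scaler0. Qed.

Lemma convex_shrink P v (s t : R) : convex_set P -> P 0 -> 0 <= s <= t ->
  P (t *: v) -> P (s *: v).
Proof.
move=> /convex_setP cP P0 /andP[s0 st] Pt.
have [t0|tn0] := eqVneq t 0.
  by rewrite (_ : s = t)//; apply/le_anti; rewrite st/= t0.
have tp : 0 < t by rewrite lt_def tn0 (le_trans s0).
have := cP _ _ (s / t) Pt P0; rewrite scaler0 addr0 scalerA divfK//; apply.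
by rewrite divr_ge0 ?(ltW tp)//= ler_pdivrMr// mul1r.
Qed.

(** Instead of averaging n + 1 points at once, each induction step takes the
    midpoint of the first term, doubled, and of the remaining sum, doubled;
    this is why the admissible radius is halved. *)
Lemma absorbing_box n (X : 'I_n -> V) P : convex_set P -> absorbing P ->
  exists2 r : R, 0 < r & forall c : 'I_n -> R,
    (forall i, `|c i| < r) -> P (\sum_(i < n) c i *: X i).
Proof.
move=> cP aP; elim: n X => [X|n IH X].
  by exists 1 => // c _; rewrite big_ord0; exact: absorbing0.
have [r r0 rP] := IH (X \o lift ord0).
have [t t0 Pt] := aP (X ord0); have [s s0 Ps] := aP (- X ord0).
exists (Num.min (r / 2) (Num.min (t / 2) (s / 2))).
  by rewrite !lt_min !divr_gt0.
move=> c cr; rewrite big_ord_recl/=.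
have /convex_setP /(_ ((2 * c ord0) *: X ord0)
    (\sum_(i < n) (2 * c (lift ord0 i)) *: X (lift ord0 i)) (2^-1)) := cP.
rewrite scaler_sumr scalerA (_ : 1 - 2^-1 = 2^-1 :> R); last lra.
rewrite mulKf ?pnatr_eq0//.
under [X in P (_ + X)]eq_bigr do rewrite scalerA mulKf ?pnatr_eq0//.
apply; last lra.
- have := cr ord0; rewrite !lt_min => /and3P[_ c1 c2].
  have [c0|c0] := leP 0 (c ord0).
    apply: (convex_shrink cP (absorbing0 aP) _ Pt).
    by move: c1; rewrite ger0_norm// => ?; lra.
  (* a negative coefficient uses the point of P on the opposite ray *)
  rewrite (_ : _ *: X _ = (2 * - c ord0) *: - X ord0); last first.
    by rewrite scalerN mulrN scaleNr opprK.
  apply: (convex_shrink cP (absorbing0 aP) _ Ps).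
  by move: c2; rewrite ltr0_norm// => ?; lra.
- apply: (rP (fun i => 2 * c (lift ord0 i))) => i; rewrite normrM ger0_norm//.
  by have := cr (lift ord0 i); rewrite !lt_min => /andP[? _]; lra.
Qed.

Lemma absorbing_interior P : convex_set P -> interiorV P 0 <-> absorbing P.
Proof.
move=> cP; have bV := vbasisP {:V}.
rewrite /interiorV /= (_ : coords (0 : V) = 0); last first.
  by apply/eqP; rewrite passmx.rVof_eq0.
split=> [/nbhs_ballP[r /= r0 rP] v|aP].
  pose C := \sum_i `|coord (vbasis {:V}) i v| + 1.
  have C0 : 0 < C by rewrite ltr_wpDl ?sumr_ge0.
  exists (r / C); first by rewrite divr_gt0.
  have [|w Pw /(can_inj (passmx.rVofK bV)) <-//] := rP (coords ((r / C) *: v)).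
  split=> // i j; rewrite ord1 /ball/= !mxE sub0r normrN linearZ normrM.
  rewrite gtr0_norm ?divr_gt0// mulrAC ltr_pdivrMr// ltr_pM2l//.
  by rewrite /C (bigD1 j)//= -addrA ltrDl ltr_wpDl ?sumr_ge0.
have [r r0 rP] :=
  absorbing_box (fun i : 'I_(\dim {:V}) => (vbasis {:V})`_i) cP aP.
apply/nbhs_ballP; exists r => //= y [_ yr].
exists (passmx.vecof (vbasis {:V}) y); last exact: passmx.vecofK.
by apply: rP => i; have := yr 0 i; rewrite /ball/= mxE sub0r normrN.
Qed.

End Absorbing.

(** An absorbing set spans the whole space, and the affine hull can be based
    at 0. *)
Lemma absorbing_has_dim {R : realType} {V : vectType R} (P : set V) :
  absorbing P -> has_dim P (\dim {:V}).
Proof.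
move=> aP; exists 0, fullv; split=> //; first exact: absorbing0.
- by move=> y _; rewrite memvf.
move=> U PU; apply/subvP => v _; have [t t0 /PU] := aP v.
by rewrite subr0 rpredZeq gt_eqF.
Qed.

(** * Dual bases and their lattices *)

(** When f is the basis dual to some basis e, the numbers b v (f i) are the
    coordinates of v on e, so this is the lattice spanned by e. *)
Definition integral_points {R : realType} {V W : vectType R} (b : V -> W -> R)
    d (f : 'I_d -> W) : set V :=
  [set v | forall i, b v (f i) \is a Num.int].

(** The fields are chosen so that flipping b and exchanging e and f preserves
    them: each result proved for V then holds for W. *)
Record dual_bases {R : realType} {V W : vectType R} (b : V -> W -> R) d
    (e : 'I_d -> V) (f : 'I_d -> W) : Prop := DualBases {
  pairDl : forall u v w, b (u + v) w = b u w + b v w;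
  pairDr : forall v w x, b v (w + x) = b v w + b v x;
  pairZl : forall t v w, b (t *: v) w = t * b v w;
  pairZr : forall t v w, b v (t *: w) = t * b v w;
  expandl : forall v, v = \sum_i b v (f i) *: e i;
  expandr : forall w, w = \sum_i b (e i) w *: f i;
  pair_delta : forall i j, b (e i) (f j) = (i == j)%:R }.

Lemma dual_bases_flip {R : realType} {V W : vectType R} (b : V -> W -> R) d
    (e : 'I_d -> V) (f : 'I_d -> W) :
  dual_bases b e f -> dual_bases (fun w v => b v w) f e.
Proof. by case=> *; split=> // i j; rewrite eq_sym. Qed.

Section OneSided.
Context {R : realType} {V W : vectType R} {b : V -> W -> R}.
Context {d : nat} {e : 'I_d -> V} {f : 'I_d -> W}.
Hypothesis ef : dual_bases b e f.
Implicit Types (u v : V) (x w : W) (s t : R).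

Lemma pair0l w : b 0 w = 0.
Proof. by have := pairZl ef 0 0 w; rewrite scale0r mul0r. Qed.

Lemma pairNl v w : b (- v) w = - b v w.
Proof. by rewrite -scaleN1r (pairZl ef) mulN1r. Qed.

Lemma pair_suml (c : 'I_d -> R) (v : 'I_d -> V) w :
  b (\sum_i c i *: v i) w = \sum_i c i * b (v i) w.
Proof.
elim/big_rec2: _ => [|i s u _ <-]; first exact: pair0l.
by rewrite (pairDl ef) (pairZl ef).
Qed.

Lemma basis_integral i : integral_points b f (e i).
Proof. by move=> j; rewrite (pair_delta ef). Qed.

Lemma integral_comb s t u v : s \is a Num.int -> t \is a Num.int ->
  integral_points b f u -> integral_points b f v ->
  integral_points b f (s *: u + t *: v).
Proof.
by move=> si ti ui vi i; rewrite (pairDl ef) !(pairZl ef) rpredD ?rpredM.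
Qed.

Lemma integralZ s u : s \is a Num.int ->
  integral_points b f u -> integral_points b f (s *: u).
Proof. by move=> si ui i; rewrite (pairZl ef) rpredM. Qed.

Lemma integralN u : integral_points b f u -> integral_points b f (- u).
Proof. by move=> ui i; rewrite pairNl rpredN. Qed.

Lemma convex_halfspace v c : convex_set [set w | c <= b v w].
Proof.
apply/convex_setP => x w t /= vx vw /andP[t0 t1].
rewrite (pairDr ef) !(pairZr ef).
have : 0 <= t * (b v x - c) + (1 - t) * (b v w - c).
  by rewrite addr_ge0// mulr_ge0 ?subr_ge0.
lra.
Qed.

Lemma polar_Conv (S : set W) : polar b (Conv S) = polar b S.
Proof.
apply/seteqP; split=> v vS w Sw; first by apply: vS; exact: sub_Conv.
suff : Conv S `<=` [set x | -1 <= b v x] by apply.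
by apply: Conv_min; [exact: convex_halfspace | exact: vS].
Qed.

End OneSided.

(** * Polars and the lattice Farkas lemma *)

Section TwoSided.
Context {R : realType} {V W : vectType R} {b : V -> W -> R}.
Context {d : nat} {e : 'I_d -> V} {f : 'I_d -> W}.
Hypothesis ef : dual_bases b e f.
Let fe := dual_bases_flip ef.
Let LV := integral_points b f.
Let LW := integral_points (fun w v => b v w) e.
Implicit Types (u v : V) (x w : W) (s t : R).

Lemma pair_integral v w : LV v -> LW w -> b v w \is a Num.int.
Proof.
move=> vi wi; rewrite [v](expandl ef) (pair_suml ef) rpred_sum// => i _.
by rewrite rpredM ?vi ?wi.
Qed.

Lemma pair_eq0 v : (forall w, LW w -> b v w = 0) -> v = 0.
Proof.
move=> v0; rewrite [v](expandl ef) big1// => i _.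
by rewrite v0 ?scale0r//; exact: (basis_integral fe).
Qed.

(** Bartl's inductive proof of the Farkas lemma, free of divisions. Suppose
    that y satisfies all constraints but the one of a, and b v y < 0. The map
    [shear] adds to -(b a y) u the multiple of a that makes it vanish on y. It
    kills a, and it is adjoint to a projection of W, up to a scalar, onto the
    hyperplane a = 0; so the induction hypothesis applies to the sheared
    vectors. Its coefficients are values of b on lattice vectors, so it
    preserves LV and its adjoint preserves LW. For u among the other
    generators both coefficients are nonnegative, hence the sheared generators
    still lie in the same cone K, which is therefore fixed throughout. *)
Lemma lattice_farkas (K : set V) (l : seq V) v :
    K 0 -> (forall u v, K u -> K v -> K (u + v)) ->
    (forall t v, 0 <= t -> K v -> K (t *: v)) ->
    {in l, forall a, LV a /\ K a} -> LV v ->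
    (forall x, LW x -> {in l, forall a, 0 <= b a x} -> 0 <= b v x) ->
  K v.
Proof.
move=> K0 KD KZ; have [n] := ubnP (size l).
elim: n l v => // n IH [|a l] v /=.
  move=> _ _ _ v_ge0; rewrite (pair_eq0 (v := v))// => w wi.
  apply/le_anti; rewrite v_ge0// andbT -oppr_ge0 -(pairNl fe).
  by apply: v_ge0 => //; exact: (integralN fe).
rewrite ltnS => ltn lK vi v_ge0.
have [aLV aK] := lK _ (mem_head a l).
have lK' : {in l, forall a, LV a /\ K a}.
  by move=> u ul; apply: lK; rewrite inE ul orbT.
have [|] := pselect
    (forall x, LW x -> {in l, forall a, 0 <= b a x} -> 0 <= b v x).
  exact: IH.
move=> /existsNP[y] /not_implyP[yi] /not_implyP[ly] /negP; rewrite -ltNge => vy.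
have ay : b a y < 0.
  rewrite ltNge; apply/negP => ay; move: vy; rewrite ltNge v_ge0//.
  by move=> u; rewrite inE => /orP[/eqP ->|/ly].
pose shear u := (- b a y) *: u + b u y *: a.
have ayi : - b a y \is a Num.int by rewrite rpredN pair_integral.
have shear_int u : LV u -> LV (shear u).
  by move=> ui; apply: (integral_comb ef) => //; exact: pair_integral.
have shear_pair u x : b (shear u) x = b u ((- b a y) *: x + b a x *: y).
  by rewrite /shear (pairDl ef) (pairDr ef) !(pairZl ef) !(pairZr ef); ring.
have : K (shear v).
  apply: (IH (map shear l)); rewrite ?size_map//.
  - move=> _ /mapP[u ul ->]; have [ui uK] := lK' u ul; split.
      exact: shear_int.
    by apply: KD; apply: KZ => //; [rewrite oppr_ge0 ltW|exact: ly].
  - exact: shear_int.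
  - move=> x xi xl; rewrite shear_pair; apply: v_ge0.
      by apply: (integral_comb fe) => //; exact: pair_integral.
    move=> u; rewrite inE => /orP[/eqP ->|ul].
      by rewrite (pairDr ef) !(pairZr ef) mulrC mulrN addrC subrr.
    by rewrite -shear_pair xl// map_f.
(* v is recovered from shear v by adding back a positive multiple of a *)
move=> Kv; rewrite (_ : v = (- b a y)^-1 *: (shear v + (- b v y) *: a)).
  apply: (KZ); first by rewrite invr_ge0 oppr_ge0 ltW.
  by apply: KD => //; apply: KZ => //; rewrite oppr_ge0 ltW.
rewrite /shear -addrA -scalerDl subrr scale0r addr0 scalerK//.
by rewrite oppr_eq0 lt_eqF.
Qed.

(** The polar of a bounded set is a neighbourhood of 0; a polytope is bounded
    because each functional takes finitely many values on its generators. *)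
Lemma absorbing_polar (P : set W) : polytope P -> absorbing (polar b P).
Proof.
move=> [S /finite_seqP[l ->] ->] v.
have [t t0 lt] : exists2 t, 0 < t & {in l, forall w, -1 <= t * b v w}.
  pose C := \sum_(w <- l) `|b v w| + 1.
  have C0 : 0 < C by rewrite ltr_wpDl ?sumr_ge0.
  exists C^-1; first by rewrite invr_gt0.
  move=> w wl; rewrite mulrC ler_pdivlMr// mulN1r lerNl.
  apply: le_trans (ler_norm _) _; rewrite normrN /C (big_rem w wl)/=.
  by rewrite -addrA lerDl addr_ge0 ?sumr_ge0.
exists t => //; rewrite (polar_Conv ef) => w wl.
by rewrite (pairZl ef) lt.
Qed.

(** Since P contains positive multiples of f i and of - f i, the i-th
    coordinate is bounded on the polar; and it is an integer on LV. *)
Lemma finite_polar_lattice (P : set W) : absorbing P ->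
  finite_set (polar b P `&` LV).
Proof.
move=> aP.
have bound i : exists n : nat, forall v, polar b P v -> `|b v (f i)| <= n%:R.
  have [s s0 Ps] := aP (f i); have [t t0 Pt] := aP (- f i).
  exists (Num.bound (Num.max s^-1 t^-1)) => v vP; apply: ltW.
  apply: le_lt_trans (archi_boundP _); last first.
    by rewrite le_max invr_ge0 ltW.
  have := vP _ Ps; have := vP _ Pt; rewrite !(pairZr ef) (pairNl fe) => vt vs.
  rewrite ler_norml le_max; apply/andP; split; last first.
    by apply/orP; right; rewrite -div1r ler_pdivlMr//; nra.
  rewrite lerNl le_max; apply/orP; left.
  by rewrite -div1r ler_pdivlMr//; nra.
have [N Nb] := choice bound.
pose m := \max_i N i.
(* integers between - m and m, shifted by m so as to index them by ordinals *)
pose g (a : {ffun 'I_d -> 'I_(m + m).+1}) : V :=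
  \sum_i ((a i)%:R - m%:R) *: e i.
apply: (@sub_finite_set _ _ (g @` setT)); last exact/finite_image/finite_finset.
move=> v [vP vi].
have coef i : exists k : 'I_(m + m).+1, b v (f i) = k%:R - m%:R.
  have le_m : `|b v (f i)| <= m%:R.
    by apply: le_trans (Nb i v vP) _; rewrite ler_nat; exact: leq_bigmax.
  have /natrP[k kE] : b v (f i) + m%:R \is a Num.nat.
    by rewrite natrEint rpredD ?vi//=; move: le_m; rewrite ler_norml; lra.
  have km : (k < (m + m).+1)%N.
    rewrite ltnS -(ler_nat R) natrD -kE lerD2r.
    exact: le_trans (ler_norm _) le_m.
  by exists (Ordinal km); rewrite /= -kE addrK.
have [k kE] := choice coef.
exists [ffun i => k i] => //; rewrite [RHS](expandl ef).
by apply: eq_bigr => i _; rewrite ffunE kE.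
Qed.

(** * The bullet of an almost reflexive polytope *)

(** Let Q be the bullet of P. The vectors with a positive multiple in Q form a
    convex cone K, and Q is absorbing iff K is everything. A lattice functional
    x that is nonnegative on the generators of Q has all its natural multiples
    in P, which is bounded; so x cannot be negative on any v, and
    [lattice_farkas] puts LV, hence V, inside K. *)
Lemma absorbing_bullet (P : set W) : polytope P ->
    bullet (fun w v => b v w) LW (bullet b LV P) `<=` P ->
  finite_set (polar b P `&` LV) -> absorbing (bullet b LV P).
Proof.
move=> polyP PP /finite_seqP[l lE].
set Q := bullet b LV P.
have /convex_setP cQ : convex_set Q by exact: convex_Conv.
have Q0 : Q 0.
  by apply: sub_Conv; split=> [w _|i]; rewrite (pair0l ef) ?lerN10.
pose K := [set v | exists2 t, 0 < t & Q (t *: v)].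
have K0 : K 0 by exists 1; rewrite ?scaler0.
have KZ t v : 0 <= t -> K v -> K (t *: v).
  rewrite le_eqVlt => /predU1P[<- _|t0 [s s0 Qs]]; first by rewrite scale0r.
  exists (s / t); first by rewrite divr_gt0.
  by rewrite scalerA divfK ?gt_eqF.
have KD u v : K u -> K v -> K (u + v).
  move=> [s s0 Qs] [t t0 Qt]; have st0 : 0 < s + t by rewrite addr_gt0.
  exists (s * t / (s + t)); first by rewrite divr_gt0 ?mulr_gt0.
  (* these weights give s u and t v the same coefficient s t / (s + t) *)
  have := cQ _ _ (t / (s + t)) Qs Qt.
  rewrite !scalerA (_ : t / (s + t) * s = s * t / (s + t)); last first.
    by field; rewrite gt_eqF.
  rewrite (_ : (1 - _) * t = s * t / (s + t)); last by field; rewrite gt_eqF.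
  rewrite -scalerDr; apply; rewrite divr_ge0 ?(ltW t0) ?(ltW st0)//=.
  by rewrite ler_pdivrMr// mul1r lerDr ltW.
have KL v : LV v -> K v.
  move=> vi; apply: (lattice_farkas (l := l)) => // [a al|x xi lx].
    have [] : (polar b P `&` LV) a by rewrite lE.
    by move=> aP ai; split=> //; exists 1; rewrite // scale1r; exact: sub_Conv.
  have Px n : P (n%:R *: x).
    apply: PP; apply: sub_Conv; split; last exact: (integralZ fe).
    rewrite (polar_Conv fe) lE => a al; rewrite (pairZr ef).
    by rewrite (@le_trans _ _ 0) ?oppr_le0 ?mulr_ge0 ?lx.
  have [t t0 tv] := absorbing_polar polyP v.
  rewrite leNgt; apply/negP => vx.
  (* a multiple n with n (- t b v x) > 1, against t v being in the polar of P *)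
  pose n := Num.bound ((- (t * b v x))^-1).
  have tvx : 0 < - (t * b v x) by rewrite oppr_gt0 pmulr_rlt0.
  have := archi_boundP (ltW (_ : 0 < (- (t * b v x))^-1)).
  rewrite invr_gt0 => /(_ tvx); rewrite -/n -div1r ltr_pdivrMr// => nlt.
  by have := tv _ (Px n); rewrite (pairZl ef) (pairZr ef); nra.
have KT v : K v.
  rewrite [v](expandl ef); elim/big_rec: _ => // i u _ Ku; apply: KD => //.
  have [c0|c0] := leP 0 (b v (f i)).
    by apply: KZ => //; apply: KL; exact: (basis_integral ef).
  rewrite -[_ *: _]opprK -scaleNr -scalerN; apply: KZ.
    by rewrite oppr_ge0 ltW.
  by apply/KL/(integralN ef); exact: (basis_integral ef).
exact: KT.
Qed.

Lemma almost_reflexive_bullet (P : set W) : \dim {:V} = d ->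
  almost_reflexive b LV LW d P ->
  almost_reflexive (fun w v => b v w) LW LV d (bullet b LV P).
Proof.
move=> dimV [[polyP _] _ intP PP].
have cP : convex_set P by case: polyP => S _ ->; exact: convex_Conv.
have fin := finite_polar_lattice (iffLR (absorbing_interior cP) intP).
have absQ : absorbing (bullet b LV P).
  by apply: absorbing_bullet => //; rewrite PP.
split.
- split; first by exists (polar b P `&` LV).
  by move=> v /vertex_Conv[].
- by rewrite -dimV; exact: absorbing_has_dim.
- by apply/absorbing_interior => //; exact: convex_Conv.
- by rewrite PP.
Qed.

End TwoSided.

(** * The dual lattice in coordinates *)

Section CoordinateFunctionals.
Context {R : realType} {MR : vectType R} {d : nat} (e : d.-tuple MR).
Hypothesis eb : basis_of {:MR} e.

Definition coord_functional (i : 'I_d) : NR MR :=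
  linfun (coord e i : MR -> R^o).

Lemma pairing_coord v i : pairing v (coord_functional i) = coord e i v.
Proof. by rewrite /pairing lfunE. Qed.

Lemma coord_dual_bases :
  dual_bases pairing (fun i : 'I_d => e`_i) coord_functional.
Proof.
split.
- by move=> u v w; rewrite /pairing linearD.
- by move=> v w x; rewrite /pairing add_lfunE.
- by move=> t v w; rewrite /pairing linearZ.
- by move=> t v w; rewrite /pairing scale_lfunE.
- move=> v; rewrite {1}(coord_basis eb (memvf v)).
  by apply: eq_bigr => i _; rewrite pairing_coord.
- move=> w; apply/lfunP => v; rewrite {1}(coord_basis eb (memvf v)).
  rewrite linear_sum sum_lfunE; apply: eq_bigr => i _.
  rewrite linearZ scale_lfunE lfunE /=; exact: mulrC.
- by move=> i j; rewrite pairing_coord coord_free ?(basis_free eb)// eq_sym.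
Qed.

Lemma span_integral_points :
  [set m | inIntSpan e m] = integral_points pairing coord_functional.
Proof.
have fe := basis_free eb.
apply/seteqP; split=> [m [a ->] i|m mi] /=.
  rewrite pairing_coord.
  under eq_bigr do rewrite -scaler_int.
  by rewrite coord_sum_free.
exists [ffun i => Num.floor (coord e i m)].
rewrite {1}(coord_basis eb (memvf m)); apply: eq_bigr => i _.
by rewrite ffunE -scaler_int floorK// -pairing_coord; exact: mi.
Qed.

Lemma dual_lattice_integral_points :
  dual_lattice [set m | inIntSpan e m] =
  integral_points (fun w v => pairing v w) (fun i : 'I_d => e`_i).
Proof.
rewrite span_integral_points; apply/seteqP; split=> n ni.
  by move=> i; apply: ni; exact: (basis_integral coord_dual_bases).
by move=> m mi; exact: (pair_integral coord_dual_bases).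
Qed.

End CoordinateFunctionals.

Theorem lemma1p14 (R : realType) (d : nat) (MR : vectType R) (M : set MR)
    (hM : is_lattice d M) :
  (forall Delta : set (NR MR),
      almost_reflexive_N d M Delta ->
      almost_reflexive_M d M (bullet_N M Delta) /\
      bullet_M M (bullet_N M Delta) = Delta) /\
  (forall Delta' : set MR,
      almost_reflexive_M d M Delta' ->
      almost_reflexive_N d M (bullet_M M Delta') /\
      bullet_N M (bullet_M M Delta') = Delta').
Proof.
case: hM => e eb ->.
have ef := coord_dual_bases eb.
have dimM : \dim {:MR} = d := size_basis eb.
have dimN : \dim {:NR MR} = d.
  by rewrite dimvf /dim /= -dimvf dimM muln1.
rewrite /almost_reflexive_M /almost_reflexive_N /bullet_N /bullet_M.
rewrite dual_lattice_integral_points// span_integral_points//.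
split=> P hP; (split; last by case: hP).
  exact: (almost_reflexive_bullet ef).
exact: (almost_reflexive_bullet (dual_bases_flip ef)).
Qed.
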